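(* Let $R$ be a nonzero ring. The following statements are equivalent. (1) $R$ is a left virtually semisimple ring. (2) $R$ is a semiprime principal left ideal ring. (3) $R$ is a left hereditary and principal left ideal ring. (4) There is a ring isomorphism $R\cong\prod_{i=1}^{k}M_{n_i}(D_i)$ for some positive integers $k,n_1,\dots,n_k$, where each $D_i$ is a (left Noetherian) domain and every $M_{n_i}(D_i)$ is a principal left ideal ring.
   Context: All rings are associative with identity (not necessarily commutative) and all modules are unitary left modules. A module $M$ is virtually semisimple if each submodule of $M$ is isomorphic to a direct summand of $M$. A ring $R$ is left virtually semisimple if the left module ${}_RR$ is virtually semisimple. A principal left ideal ring is a ring in which every left ideal is principal. A ring is semiprime if it has no nonzero two-sided ideal $I$ with $I^2=0$. A ring is left hereditary if every left ideal is a projective left module. A domain is a nonzero (not necessarily commutative) ring without zero divisors. $M_n(D)$ denotes the ring of $n\times n$ matrices over $D$. *)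

(* Defs.v *)
From HB Require Import structures.
From mathcomp Require Import all_boot all_algebra.

Set Implicit Arguments.
Unset Strict Implicit.
Unset Printing Implicit Defensive.

Import GRing.Theory.
Local Open Scope ring_scope.

(* Modules are left modules (lmodType), and R^o is the left module R over      *)
(* itself.  Rings are not assumed commutative; pzRingType allows the zero ring *)
(* and nzRingType excludes it.  A submodule is a library submodClosed, i.e. a  *)
(* bool-valued predicate closed under the module operations; classically this  *)
(* is no restriction, every subset having a bool-valued indicator.             *)

Section SubmoduleAsModule.
Variables (R : pzRingType) (M : lmodType R) (N : submodClosed M).

(* A record rather than {x | x \in N}, so that the lmodType instance is found  *)
(* from the type alone.                                                        *)
Record submodule := Submodule { submodule_val : M; _ : submodule_val \in N }.

HB.instance Definition _ := [isSub for submodule_val].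
HB.instance Definition _ := [Choice of submodule by <:].
HB.instance Definition _ := [SubChoice_isSubLmodule of submodule by <:].

End SubmoduleAsModule.

Definition isomorphic_modules (R : pzRingType) (M N : lmodType R) : Prop :=
  exists f : {linear M -> N}, bijective f.

Definition direct_summand (R : pzRingType) (M : lmodType R)
    (K : submodClosed M) : Prop :=
  exists L : submodClosed M,
    (forall x, x \in K -> x \in L -> x = 0) /\
    (forall x, exists y z, [/\ y \in K, z \in L & x = y + z]).

Definition virtually_semisimple (R : pzRingType) (M : lmodType R) : Prop :=
  forall N : submodClosed M, exists K : submodClosed M,
    direct_summand K /\ isomorphic_modules (submodule N) (submodule K).

Definition left_virtually_semisimple (R : pzRingType) : Prop :=
  virtually_semisimple R^o.

Definition left_ideal (R : pzRingType) := submodClosed R^o.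

Definition principal (R : pzRingType) (I : left_ideal R) : Prop :=
  exists a : R, forall x : R, x \in I <-> exists r : R, x = r * a.

Definition principal_left_ideal_ring (R : pzRingType) : Prop :=
  forall I : left_ideal R, principal I.

Definition two_sided (R : pzRingType) (I : left_ideal R) : Prop :=
  forall x r : R, x \in I -> x * r \in I.

(* The product I J: finite sums of products a b with a in I and b in J. *)
Definition ideal_product (R : pzRingType) (I J : left_ideal R) (x : R) : Prop :=
  exists (n : nat) (a b : 'I_n -> R),
    [/\ forall i, a i \in I, forall i, b i \in J & x = \sum_(i < n) a i * b i].

Definition semiprime (R : pzRingType) : Prop :=
  forall I : left_ideal R, two_sided I ->
    (forall x, ideal_product I I x -> x = 0) -> forall x, x \in I -> x = 0.

Definition projective (R : pzRingType) (P : lmodType R) : Prop :=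
  forall (A B : lmodType R) (g : {linear A -> B}) (f : {linear P -> B}),
    (forall b, exists a, g a = b) ->
    exists h : {linear P -> A}, forall p, g (h p) = f p.

Definition left_hereditary (R : pzRingType) : Prop :=
  forall I : left_ideal R, projective (submodule I).

Definition left_noetherian (R : pzRingType) : Prop :=
  forall I : nat -> left_ideal R,
    (forall m, {subset I m <= I m.+1}) ->
    exists m0, forall m, (m0 <= m)%N -> I m =i I m0.

Definition domain (D : nzRingType) : Prop :=
  forall x y : D, x * y = 0 -> x = 0 \/ y = 0.

Definition isomorphic_rings (R S : pzRingType) : Prop :=
  exists f : {rmorphism R -> S}, bijective f.

(* The library only has powers of a single ring as finite functions; this is   *)
(* the componentwise ring structure on a product of varying rings.             *)
Section ProductRing.
Variables (I : finType) (T : I -> pzRingType).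
Local Notation prodT := {dffun forall i : I, T i}.
Implicit Types f g h : prodT.

Let add f g : prodT := [ffun i => f i + g i].
Let opp f : prodT := [ffun i => - f i].
Let mul f g : prodT := [ffun i => f i * g i].
Let zero : prodT := [ffun i => 0].
Let one : prodT := [ffun i => 1].

Fact dffun_addA : associative add.
Proof. by move=> f g h; apply/ffunP=> i; rewrite !ffunE addrA. Qed.
Fact dffun_addC : commutative add.
Proof. by move=> f g; apply/ffunP=> i; rewrite !ffunE addrC. Qed.
Fact dffun_add0 : left_id zero add.
Proof. by move=> f; apply/ffunP=> i; rewrite !ffunE add0r. Qed.
Fact dffun_addN : left_inverse zero opp add.
Proof. by move=> f; apply/ffunP=> i; rewrite !ffunE addNr. Qed.
HB.instance Definition _ := GRing.isZmodule.Build prodT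
  dffun_addA dffun_addC dffun_add0 dffun_addN.

Fact dffun_mulA : associative mul.
Proof. by move=> f g h; apply/ffunP=> i; rewrite !ffunE mulrA. Qed.
Fact dffun_mul1l : left_id one mul.
Proof. by move=> f; apply/ffunP=> i; rewrite !ffunE mul1r. Qed.
Fact dffun_mul1r : right_id one mul.
Proof. by move=> f; apply/ffunP=> i; rewrite !ffunE mulr1. Qed.
Fact dffun_mulDl : left_distributive mul add.
Proof. by move=> f g h; apply/ffunP=> i; rewrite !ffunE mulrDl. Qed.
Fact dffun_mulDr : right_distributive mul add.
Proof. by move=> f g h; apply/ffunP=> i; rewrite !ffunE mulrDr. Qed.
HB.instance Definition _ := GRing.Zmodule_isPzRing.Build prodT
  dffun_mulA dffun_mul1l dffun_mul1r dffun_mulDl dffun_mulDr.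

End ProductRing.

(* Main.v *)
From HB Require Import structures.
Require Import Defs.
From mathcomp Require Import all_boot all_algebra boolp.

Set Implicit Arguments.
Unset Strict Implicit.
Unset Printing Implicit Defensive.

Import GRing.Theory.
Local Open Scope ring_scope.

(** Throughout, R is a ring whose left ideals are all principal; it satisfies the
    ascending chain condition.  The property that ties the four conditions
    together is nonsingularity: no essential left ideal annihilates a nonzero
    element.

    Its use is that an essential left ideal R c has a regular generator
    ([essential_regular]), so that R c is isomorphic to R.  Every left ideal R a
    has a complement C with R a + C essential, hence equal to such an R c
    ([essential_complement], [essential_generator]).  Two consequences: R a is a
    direct summand of a free module, so it is projective
    ([nonsingular_projective_gen]); and if R a is two-sided with square zero, it
    kills c, so it vanishes ([nonsingular_semiprime]).  Conversely projectivity
    of all R a makes every annihilator a direct summand, which cannot be essential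
    unless it is everything, and in a semiprime ring the singular ideal vanishes
    by the chain condition ([semiprime_nonsingular]).  Since R a is projective
    exactly when it is isomorphic to a summand R e, conditions (1), (2) and (3)
    are thus all equivalent to R being nonsingular with principal left ideals.

    For (4), call uniform left ideals linked when the product of one by the other
    is nonzero; semiprimeness makes this an equivalence, and linked uniform left
    ideals embed in each other.  Fix one representative of each class.  A maximal
    independent family of copies of representatives has an essential sum, and
    this sum, being R c with c regular, is isomorphic to R.  Hence R itself is a
    direct sum of uniform left ideals any two of which are isomorphic or have no
    nonzero homomorphism between them ([exists_decomposition]), and its
    endomorphism ring R is a product of matrix rings over the endomorphism rings
    e R e of the representatives, which are domains ([corner_domain]).

    In the other direction, matrix rings over domains are semiprime, and products
    inherit both semiprimeness and principality of left ideals from their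
    factors. *)

(** * Left ideals and the ascending chain condition *)

Section LeftIdeals.
Variable R : pzRingType.
Implicit Types (I J C : R -> Prop) (r x y z a c : R).

(** Left ideals as arbitrary predicates: unlike the bundled boolean ones they
    can be formed from any formula. *)
Definition lideal I :=
  [/\ I 0, forall x y, I x -> I y -> I (x + y) & forall r x, I x -> I (r * x)].

Definition lmul y x := exists r, x = r * y.
Definition lann y x := x * y = 0.
Definition isum I J x := exists y z, [/\ I y, J z & x = y + z].

Lemma lideal_lmul y : lideal (lmul y).
Proof.
split=> [|_ _ [r ->] [s ->]|r _ [s ->]]; first by exists 0; rewrite mul0r.
- by exists (r + s); rewrite mulrDl.
- by exists (r * s); rewrite mulrA.
Qed.

Lemma lmul_id y : lmul y y.
Proof. by exists 1; rewrite mul1r. Qed.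

Lemma lideal_lann y : lideal (lann y).
Proof.
split=> [|a b a0 b0|r a a0]; rewrite /lann; first by rewrite mul0r.
- by rewrite mulrDl a0 b0 addr0.
- by rewrite -mulrA a0 mulr0.
Qed.

Lemma lidealB I x y : lideal I -> I x -> I y -> I (x - y).
Proof.
by move=> [_ ID IM] Ix Iy; apply: ID; rewrite // -mulN1r; apply: IM.
Qed.

Lemma lideal_isum I J : lideal I -> lideal J -> lideal (isum I J).
Proof.
move=> [I0 ID IM] [J0 JD JM]; split.
- by exists 0, 0; rewrite addr0.
- move=> _ _ [y1 [z1 [Iy1 Jz1 ->]]] [y2 [z2 [Iy2 Jz2 ->]]].
  by exists (y1 + y2), (z1 + z2); rewrite addrACA; split; [apply: ID|apply: JD|].
- move=> r _ [y [z [Iy Jz ->]]]; exists (r * y), (r * z).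
  by rewrite mulrDr; split; [apply: IM|apply: JM|].
Qed.

Lemma isuml I J x : lideal J -> I x -> isum I J x.
Proof. by move=> [J0 _ _] Ix; exists x, 0; rewrite addr0. Qed.

Lemma isumr I J x : lideal I -> J x -> isum I J x.
Proof. by move=> [I0 _ _] Jx; exists 0, x; rewrite add0r. Qed.

Lemma lideal_sum I (T : finType) (f : T -> R) :
  lideal I -> (forall i, I (f i)) -> I (\sum_i f i).
Proof. by case=> I0 ID _ If; apply: big_ind. Qed.

Lemma lideal_closed (I : left_ideal R) : lideal (fun x => x \in I).
Proof.
split=> [|x y Ix Iy|r x Ix]; [exact: rpred0|exact: rpredD|].
exact: (@rpredZ R R^o).
Qed.

Lemma closed_lideal I : lideal I ->
  exists N : left_ideal R, forall x, (x \in N) <-> I x.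
Proof.
move=> [I0 ID IM]; pose S : {pred R^o} := fun x => `[<I x>].
have Sc : submod_closed S.
  split=> [|r x y]; first by apply/asboolP.
  by move=> /asboolP Ix /asboolP Iy; apply/asboolP/ID => //; apply: IM.
pose mx := GRing.isSubmodClosed.Build R R^o S Sc.
by exists (HB.pack S mx : left_ideal R) => x; split=> /asboolP.
Qed.

Definition pli := forall I, lideal I ->
  exists a, I a /\ forall x, I x -> lmul a x.

Lemma pliP : principal_left_ideal_ring R <-> pli.
Proof.
split=> [PR I idI|PR N].
  have [N NE] := closed_lideal idI; have [a Na] := PR N.
  exists a; split=> [|x Ix]; first by apply/NE/Na; exists 1; rewrite mul1r.
  exact/Na/NE.
have [a [Na aN]] := PR _ (lideal_closed N).
exists a => x; split=> [/aN//|[r ->]]; exact: (@rpredZ R R^o).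
Qed.

(** Principal left ideals satisfy the ascending chain condition because a
    generator of the union of a chain already lies in one of its terms. *)
Lemma pli_acc (F : nat -> R -> Prop) : pli ->
  (forall n, lideal (F n)) -> (forall n x, F n x -> F n.+1 x) ->
  exists n, forall m x, F m x -> F n x.
Proof.
move=> PR idF incF.
have leF n m x : (n <= m)%N -> F n x -> F m x.
  by move=> /subnK <- Fx; elim: (m - n)%N => // k IH; rewrite addSn; apply: incF.
have [|a [[n Fa] aF]] := PR (fun x => exists n, F n x).
  split=> [|x y [n Fx] [m Fy]|r x [n Fx]].
  - by exists 0%N; case: (idF 0%N).
  - exists (maxn n m); case: (idF (maxn n m)) => _ ID _.
    by apply: ID; [apply: leF Fx; rewrite leq_maxl|apply: leF Fy; rewrite leq_maxr].
  - by exists n; case: (idF n) => _ _; apply.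
exists n => m x Fx; have [|r ->] := aF x; first by exists m.
by case: (idF n) => _ _; apply.
Qed.

(** The maximum principle, by dependent choice from the chain condition.  Indexed
    families make it applicable to annihilators of elements and to spans of
    families as well as to left ideals themselves. *)
Lemma pli_max (T : Type) (P : T -> Prop) (F : T -> R -> Prop) (t0 : T) : pli ->
  (forall t, P t -> lideal (F t)) -> P t0 ->
  exists t, P t /\
    forall s, P s -> (forall x, F t x -> F s x) -> forall x, F s x -> F t x.
Proof.
move=> PR idF Pt0; apply: contrapT => noMax.
have bigger (t : {t | P t}) : exists s : {t | P t},
    (forall x, F (sval t) x -> F (sval s) x) /\
    ~ (forall x, F (sval s) x -> F (sval t) x).
  apply: contrapT => noS; apply: noMax; exists (sval t); split=> [|s Ps ts].
    exact: svalP.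
  apply: contrapT => nst; apply: noS; by exists (exist _ s Ps).
have [g gP] := choice bigger.
pose s n := iter n g (exist _ t0 Pt0).
have [n||n nF] := pli_acc (F := fun n => F (sval (s n))) PR.
- exact/idF/svalP.
- by move=> n x; apply: (gP (s n)).1.
- by apply: (gP (s n)).2; apply: nF n.+1.
Qed.

(** * Essential left ideals and nonsingular rings *)

Definition essential I := forall x, x != 0 -> exists r, r * x != 0 /\ I (r * x).

(** This is what semiprimeness and heredity have in common: when all left ideals
    are principal it is equivalent to each of them. *)
Definition nonsingular := forall y, essential (lann y) -> y = 0.

Lemma essential_sub I J : (forall x, I x -> J x) -> essential I -> essential J.
Proof. by move=> IJ eI x /eI[r [rx /IJ]]; exists r. Qed.

(** C is maximal among the left ideals disjoint from I: were some R x disjoint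
    from I + C, the left ideal C + R x would still be disjoint from I. *)
Lemma essential_complement I : pli -> lideal I ->
  exists C, [/\ lideal C, forall x, I x -> C x -> x = 0 & essential (isum I C)].
Proof.
move=> PR idI.
pose P C := lideal C /\ forall x, I x -> C x -> x = 0.
have [C []//||C [[idC IC] Cmax]] :=
  pli_max (P := P) (F := id) (t0 := fun x => x = 0) PR.
  by split=> //; split=> // [x y -> ->|r x ->]; rewrite ?addr0 ?mulr0.
exists C; split=> // x x0; apply: contrapT => noR.
have idIC := lideal_isum idI idC.
have CxI y : I y -> isum C (lmul x) y -> y = 0.
  move=> Iy [t [_ [Ct [r ->] yE]]].
  have ICrx : isum I C (r * x).
    have -> : r * x = y - t by rewrite yE addrC addKr.
    by apply: lidealB; [|apply: isuml|apply: isumr].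
  have rx0 : r * x = 0.
    by apply: contrapT => /eqP rx0; apply: noR; exists r.
  by apply: IC Iy _; rewrite yE rx0 addr0.
case: noR; exists 1; rewrite mul1r; split=> //; apply: isumr => //.
apply: (Cmax (isum C (lmul x))).
- by split=> //; apply: lideal_isum => //; apply: lideal_lmul.
- by move=> y Cy; apply: isuml => //; apply: lideal_lmul.
- by apply: isumr => //; apply: lmul_id.
Qed.

(** Right multiplication by c carries the essential R d to an essential submodule
    of R c, because annihilators of nonzero elements are not essential. *)
Lemma essential_mul d c : nonsingular ->
  essential (lmul d) -> essential (lmul c) -> essential (lmul (d * c)).
Proof.
move=> NS ed ec z z0; have [s [sz [t tE]]] := ec z z0.
suff [q [qtc [w qt]]] : exists q, q * (t * c) != 0 /\ lmul d (q * t).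
  by exists (q * s); rewrite -mulrA tE qtc mulrA qt -mulrA; split=> //; exists w.
(* Otherwise the left ideal of the q with q t in R d, which is essential,
   annihilates t c. *)
apply: contrapT => noq; suff /NS tc0 : essential (lann (t * c)).
  by move: sz; rewrite tE tc0 eqxx.
move=> y y0; have [yt|/ed[p [pyt dpyt]]] := eqVneq (y * t) 0.
  by exists 1; rewrite !mul1r /lann mulrA yt mul0r.
exists p; split; first by apply: contraNneq pyt => py; rewrite mulrA py mul0r.
apply: contrapT => /eqP pytc; apply: noq; exists (p * y).
by split=> //; rewrite -mulrA.
Qed.

(** Since R c ^+ n is essential for all n, an element x killed by c has a
    nonzero multiple r c ^+ n; then r kills c ^+ n.+1, hence c ^+ n as soon as
    the annihilators of the powers have stabilised. *)
Lemma essential_regular c : pli -> nonsingular -> essential (lmul c) ->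
  forall x, x * c = 0 -> x = 0.
Proof.
move=> PR NS ec x xc.
have ecn n : essential (lmul (c ^+ n)).
  elim: n => [|n IH]; last by rewrite exprSr; apply: essential_mul.
  by move=> z z0; exists 1; rewrite mul1r; split=> //; exists z; rewrite mulr1.
have [n|n y|n nF] := pli_acc (F := fun n => lann (c ^+ n)) PR.
- exact: lideal_lann.
- by rewrite /lann exprSr mulrA => ->; rewrite mul0r.
apply: contrapT => /eqP/(ecn n)[s [sx [r sxE]]]; case/eqP: sx; rewrite sxE.
by apply: (nF n.+1); rewrite /lann exprSr mulrA -sxE -mulrA xc mulr0.
Qed.

Lemma essential_generator I : pli -> nonsingular -> lideal I -> essential I ->
  exists c, [/\ I c, forall x, I x -> lmul c x & forall x, x * c = 0 -> x = 0].
Proof.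
move=> PR NS idI eI; have [c [Ic cI]] := PR _ idI; exists c; split=> //.
by apply: essential_regular => //; apply: essential_sub eI.
Qed.

(** * Semiprimeness *)

Definition semiprime_elt := forall a, (forall r, a * r * a = 0) -> a = 0.

(** If a R a = 0 then T := lann (R a) is a two-sided ideal containing a, and so
    is its intersection with its right annihilator, which squares to zero. *)
Lemma semiprime_eltP : semiprime R -> semiprime_elt.
Proof.
move=> SR a aRa.
pose T x := forall r, x * r * a = 0.
pose I x := T x /\ forall t, T t -> t * x = 0.
have TM r x s : T x -> T (r * x * s).
  move=> Tx q; have -> : r * x * s * q * a = r * (x * (s * q) * a).
    by rewrite !mulrA.
  by rewrite Tx mulr0.
have [|N NE] := @closed_lideal I.
  split=> [|x y [Tx Ix] [Ty Iy]|r x [Tx Ix]].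
  - by split=> [r|t _]; rewrite ?mul0r ?mulr0.
  - split=> [r|t Tt]; first by rewrite !mulrDl Tx Ty addr0.
    by rewrite mulrDr Ix ?Iy ?addr0.
  - split=> [|t Tt]; first by have := TM r x 1 Tx; rewrite mulr1.
    by rewrite mulrA Ix //; have := TM 1 t r Tt; rewrite mul1r.
apply: (SR N) => [x r /NE[Tx Ix]|x [n [f [g [Nf Ng ->]]]]|].
- apply/NE; split=> [|t Tt]; first by have := TM 1 x r Tx; rewrite mul1r.
  by rewrite mulrA Ix ?mul0r.
- rewrite big1 // => i _; have [Tf _] := (NE _).1 (Nf i).
  by have [_] := (NE _).1 (Ng i); apply.
- by apply/NE; split=> // t Tt; have := Tt 1; rewrite mulr1.
Qed.

Lemma semiprime_sym a b : semiprime_elt ->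
  (forall r, a * r * b = 0) -> forall r, b * r * a = 0.
Proof.
move=> SR aRb r; apply: SR => s.
by rewrite -!mulrA (mulrA a) (mulrA (a * s)) aRb mul0r !mulr0.
Qed.

(** Among the nonzero y with an essential annihilator take one with the largest
    annihilator.  For every r, lann (r y) meets R y nontrivially, so lann (y r y)
    is strictly larger than lann y, whence y r y = 0. *)
Lemma semiprime_nonsingular : pli -> semiprime_elt -> nonsingular.
Proof.
move=> PR SR y0 ey0; apply: contrapT => /eqP y00.
have [t _|//|y [[y_n0 ey] ymax]] :=
  pli_max (P := fun y => y != 0 /\ essential (lann y)) (F := lann) (t0 := y0) PR.
  exact: lideal_lann.
case/eqP: y_n0; apply: SR => r; apply: contrapT => /eqP yry.
have ery : essential (lann (r * y)).
  move=> z z0; have [zr|/ey[s [szr /eqP szry]]] := eqVneq (z * r) 0.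
    by exists 1; rewrite mul1r /lann mulrA zr mul0r.
  exists s; split; first by apply: contraNneq szr => sz; rewrite mulrA sz mul0r.
  by apply/eqP; rewrite mulrA -(mulrA s).
have y_n0 : y != 0 by apply: contraNneq yry => ->; rewrite mulr0.
have [s [/eqP sy syry]] := ery y y_n0; apply: sy.
apply: (ymax (y * r * y)) => [|x|].
- split=> //; apply: essential_sub ey => x; rewrite /lann => xy.
  by rewrite !mulrA xy !mul0r.
- by rewrite /lann => xy; rewrite !mulrA xy !mul0r.
- by rewrite /lann !mulrA in syry *.
Qed.

(** With I a two-sided ideal of square zero and C a complement of it,
    I + C = R c with c regular; but I c is contained in I I + (I meet C) = 0. *)
Lemma nonsingular_semiprime : pli -> nonsingular -> semiprime R.
Proof.
move=> PR NS I I2 II x Ix; have idI := lideal_closed I.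
have [C [idC IC eIC]] := essential_complement PR idI.
have [c [[i [t [Ii Ct ->]]] _ creg]] :=
  essential_generator PR NS (lideal_isum idI idC) eIC.
have xi : x * i = 0.
  apply: II; exists 1%N, (fun=> x), (fun=> i); split=> //; by rewrite big_ord1.
have xt : x * t = 0 by apply: IC; [apply: I2|case: idC => _ _; apply].
by apply: creg; rewrite mulrDr xi xt addr0.
Qed.

(** * Projectivity of principal left ideals *)

(** The left ideal R a is projective: x a |-> x e is a section of the map
    x |-> x a from R onto R a. *)
Definition projective_gen a :=
  exists e, e * a = a /\ forall x, x * a = 0 -> x * e = 0.

(** Then right multiplication by e is idempotent, since 1 - e kills a. *)
Lemma projective_gen_idem a e :
  e * a = a -> (forall x, x * a = 0 -> x * e = 0) -> e * e = e.
Proof.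
move=> ea ann; apply/eqP; rewrite -subr_eq0 -[X in _ - X]mul1r -mulrBl.
by apply/eqP/ann; rewrite mulrBl ea mul1r subrr.
Qed.

(** If x y |-> x e splits the projection onto R y, then R e meets lann y in 0. *)
Lemma projective_gen_nonsingular : (forall a, projective_gen a) -> nonsingular.
Proof.
move=> pR y ey; have [e [e_y ann]] := pR y.
apply: contrapT => /eqP y0.
have [|r [/eqP re /ann]] := ey e.
  by apply: contraNneq y0 => e0; rewrite -e_y e0 mul0r.
by rewrite -mulrA (projective_gen_idem e_y ann).
Qed.

(** R a is a direct summand of the left ideal R a + C = R c, which is free on the
    regular element c. *)
Lemma nonsingular_projective_gen a : pli -> nonsingular -> projective_gen a.
Proof.
move=> PR NS.
have idI := lideal_lmul a; have [C [idC IC eIC]] := essential_complement PR idI.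
have [c [[_ [t [[s ->] Ct cE]]] cIC creg]] :=
  essential_generator PR NS (lideal_isum idI idC) eIC.
have [b aE] : lmul c a by apply/cIC/isuml => //; apply: lmul_id.
have bt : b * t = 0.
  apply: IC; last by case: idC => _ _; apply.
  have -> : b * t = a - b * (s * a) by rewrite {1}aE cE mulrDr addrC addKr.
  by exists (1 - b * s); rewrite mulrBl mul1r mulrA.
exists (b * s); split=> [|x xa].
  by rewrite {2}aE cE mulrDr bt addr0 mulrA.
by rewrite mulrA (creg (x * b)) ?mul0r // -mulrA -aE.
Qed.

End LeftIdeals.

(** * Virtual semisimplicity and heredity *)

Section Modules.
Variable R : pzRingType.
Implicit Types (x y z a e r : R) (N K : left_ideal R).

Lemma mem_lmul N a r : a \in N -> r * a \in N.
Proof. exact: (@rpredZ R R^o). Qed.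

Section Generator.
Variables (N : left_ideal R) (a : R) (aN : a \in N).

Definition gen : submodule N := @Submodule R R^o N a aN.

Lemma val_gen r : val (r *: gen) = r * a. Proof. by []. Qed.

End Generator.

(** The component e of 1 in a direct summand K is an idempotent generator. *)
Lemma direct_summand_unit K : direct_summand K ->
  exists2 e, e \in K & forall z, z \in K -> z * e = z.
Proof.
move=> [L [KL KDL]]; have [e [l [Ke Ll oneE]]] := KDL 1.
exists e => // z Kz; apply/eqP; rewrite -subr_eq0; apply/eqP/KL.
  by apply: (lidealB (lideal_closed K)) => //; apply: mem_lmul.
have -> : z * e - z = - z * l.
  by rewrite -{2}[z]mulr1 oneE mulrDr opprD addrA subrr add0r mulNr.
exact: mem_lmul.
Qed.

(** A summand of R is principal, so whatever is isomorphic to one is principal. *)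
Lemma virtually_semisimple_pli : left_virtually_semisimple R -> pli R.
Proof.
move=> VR; apply/pliP => N; have [K [dK [f [g fK gK]]]] := VR N.
have [e Ke eK] := direct_summand_unit dK.
exists (val (g (gen Ke))) => x; split=> [Nx|[r ->]]; last first.
  by apply: mem_lmul; apply: (valP (g (gen Ke))).
exists (val (f (gen Nx))); rewrite -[RHS]/(val (_ *: g (gen Ke))).
suff <- : gen Nx = val (f (gen Nx)) *: g (gen Ke) by [].
apply: (can_inj fK); rewrite linearZ gK; apply: val_inj.
by rewrite val_gen eK //; apply: (valP (f (gen Nx))).
Qed.

(** Let K = R e be a summand isomorphic to R a, and k the image of a in K.  Then
    k generates K, so e = s k; and k s fixes k and is killed by whatever kills
    k, which means a. *)
Lemma virtually_semisimple_projective_gen a :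
  left_virtually_semisimple R -> projective_gen a.
Proof.
move=> VR; have [N NE] := closed_lideal (lideal_lmul a).
have Na : a \in N by apply/NE/lmul_id.
have [K [dK [f [g fK gK]]]] := VR N.
have [e Ke eK] := direct_summand_unit dK.
pose k : R := val (f (gen Na)).
have kK : k \in K by apply: (valP (f (gen Na))).
have annk x : x * k = 0 <-> x * a = 0.
  have fx : val (f (x *: gen Na)) = x * k by rewrite linearZ.
  split=> [xk|xa]; last first.
    have -> : x * k = val (f 0).
      by rewrite -fx; congr (val (f _)); apply: val_inj.
    by rewrite linear0.
  have /(can_inj fK)/(congr1 val) // : f (x *: gen Na) = f 0.
  by apply: val_inj; rewrite fx xk linear0.
have [s eE] : lmul k e.
  have /NE[s sE] := valP (g (gen Ke)); exists s.
  have -> : e = val (f (g (gen Ke))) by rewrite gK.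
  have -> : g (gen Ke) = s *: gen Na by apply: val_inj.
  by rewrite linearZ.
exists (k * s); split=> [|x /annk xk]; last by rewrite mulrA xk mul0r.
apply/eqP; rewrite -subr_eq0 -[X in _ - X]mul1r -mulrBl; apply/eqP/annk.
by rewrite mulrBl mul1r -mulrA -eE eK ?subrr.
Qed.

(** The image of a under a section of x |-> x a is the required e. *)
Lemma hereditary_projective_gen a : left_hereditary R -> projective_gen a.
Proof.
move=> HR; have [N NE] := closed_lideal (lideal_lmul a).
have Na : a \in N by apply/NE/lmul_id.
pose g (x : R^o) : submodule N := (x : R) *: gen Na.
have gL : linear g by move=> r x y; rewrite /g scalerDl scalerA.
pose g' : {linear R^o -> submodule N} := HB.pack g
  (GRing.isLinear.Build _ _ _ _ g gL).
have [b|h hP] := HR N _ _ g' idfun.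
  have /NE[r rE] := valP b; exists r; exact: val_inj.
exists (h (gen Na)); split=> [|x xa].
  by have /(congr1 val) := hP (gen Na).
rewrite -[LHS]/(x *: h (gen Na)) -linearZ.
have -> : x *: gen Na = 0 by apply: val_inj.
by rewrite linear0.
Qed.

Lemma projective_gen_hereditary :
  pli R -> (forall a, projective_gen a) -> left_hereditary R.
Proof.
move=> PR pR N A B g f gS.
have [a [Na aN]] := PR _ (lideal_closed N).
have [e [ea ann]] := pR a; have [alpha alphaE] := gS (f (gen Na)).
have [c cE] := choice (fun x : submodule N => aN _ (valP x)).
have xE (x : submodule N) : x = c x *: gen Na by apply: val_inj; exact: cE.
(* c x is determined up to lann a, which is killed by e; so h is linear although
   c need not be. *)
pose h (x : submodule N) := (c x * e) *: alpha.
have hL : linear h.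
  move=> r x y; rewrite /h scalerA mulrA -scalerDl -mulrDl; congr (_ *: _).
  apply/eqP; rewrite -subr_eq0 -mulrBl; apply/eqP/ann.
  by rewrite mulrBl mulrDl -mulrA -!cE; apply/eqP; rewrite subr_eq0.
exists (HB.pack h (GRing.isLinear.Build _ _ _ _ h hL) : {linear _ -> _}) => x.
have eG : e *: gen Na = gen Na by apply: val_inj.
by rewrite /= /h linearZ /= alphaE -scalerA -linearZ eG -linearZ -xE.
Qed.

(** R a is isomorphic to R e, where e is the idempotent through which right
    multiplication by a splits, and R e is a complement of R (1 - e). *)
Lemma projective_gen_virtually_semisimple :
  pli R -> (forall a, projective_gen a) -> left_virtually_semisimple R.
Proof.
move=> PR pR N.
have [a [Na aN]] := PR _ (lideal_closed N).
have [e [ea ann]] := pR a; have ee := projective_gen_idem ea ann.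
have [K KE] := closed_lideal (lideal_lmul e).
have [L LE] := closed_lideal (lideal_lmul (1 - e)).
have Ke : e \in K by apply/KE/lmul_id.
exists K; split.
  exists L; split=> [x /KE[r ->] /LE[s sE]|x].
    by rewrite -ee mulrA sE -mulrA mulrBl mul1r ee subrr mulr0.
  exists (x * e), (x * (1 - e)); split.
  - by apply/KE; exists x.
  - by apply/LE; exists x.
  - by rewrite -mulrDr addrC subrK mulr1.
have [c cE] := choice (fun x : submodule N => aN _ (valP x)).
pose f (x : submodule N) := c x *: gen Ke.
have fL : linear f.
  move=> r x y; apply: val_inj; rewrite /f scalerA -scalerDl !val_gen.
  apply/eqP; rewrite -subr_eq0 -mulrBl; apply/eqP/ann.
  by rewrite mulrBl mulrDl -mulrA -!cE; apply/eqP; rewrite subr_eq0.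
exists (HB.pack f (GRing.isLinear.Build _ _ _ _ f fL) : {linear _ -> _}).
exists (fun z : submodule K => (val z : R) *: gen Na) => x; apply: val_inj.
  by transitivity (c x * e * a); rewrite // -mulrA ea -cE.
pose y : submodule N := (val x : R) *: gen Na.
have /KE[r rE] := valP x; transitivity (c y * e) => //.
apply/eqP; rewrite [X in _ == X]rE -subr_eq0 -mulrBl; apply/eqP/ann.
by rewrite mulrBl -cE val_gen [val x]rE -mulrA ea subrr.
Qed.

End Modules.

(** * Direct products and matrix rings over domains *)

Section Product.
Variables (R : pzRingType) (I : finType) (T : I -> pzRingType).
Variable f : {rmorphism R -> {dffun forall i, T i}}.
Hypothesis f_bij : bijective f.

Lemma component_surj i (x : T i) : exists r, f r i = x.
Proof.
have [g _ gK] := f_bij.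
exists (g [ffun j : I => @dfwith I T (fun=> 0) i x j]).
by rewrite gK ffunE dfwith_in.
Qed.

Lemma componentD i x y : f (x + y) i = f x i + f y i.
Proof. by rewrite rmorphD ffunE. Qed.

Lemma componentM i x y : f (x * y) i = f x i * f y i.
Proof. by rewrite rmorphM ffunE. Qed.

Lemma component0 i : f 0 i = 0.
Proof. by rewrite rmorph0 ffunE. Qed.

Lemma component_inj x y : (forall i, f x i = f y i) -> x = y.
Proof. by move=> xy; apply: (bij_inj f_bij); apply/ffunP. Qed.

Lemma product_semiprime :
  (forall i, semiprime_elt (T i)) -> semiprime_elt R.
Proof.
move=> ST a aRa; apply: component_inj => i; rewrite component0.
apply: ST => t; have [r <-] := component_surj t.
by rewrite -!componentM aRa component0.
Qed.

(** Generators of the components of J, lifted to J, are glued with the help of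
    the central idempotents of the product. *)
Lemma product_pli : (forall i, pli (T i)) -> pli R.
Proof.
move=> PT J idJ; have [J0 JD JM] := idJ.
have gens i : exists x, J x /\ forall y, J y -> lmul (f x i) (f y i).
  have [|_ [[x [Jx <-]] xJ]] := PT i (fun t => exists x, J x /\ f x i = t).
    split=> [|_ _ [x [Jx <-]] [y [Jy <-]]|t _ [x [Jx <-]]].
    - by exists 0; rewrite component0.
    - by exists (x + y); rewrite componentD; split=> //; apply: JD.
    - have [r <-] := component_surj t.
      by exists (r * x); rewrite componentM; split=> //; apply: JM.
  by exists x; split=> // y Jy; apply: xJ; exists y.
have [x xP] := choice gens; have [g fK gK] := f_bij.
pose delta i : {dffun forall i, T i} := [ffun j : I => (i == j)%:R].
pose a := \sum_i g (delta i) * x i.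
have aE j : f a j = f (x j) j.
  rewrite /a (big_morph (fun r => f r j) (componentD j) (component0 j)).
  rewrite (bigD1 j) //= big1 ?addr0 => [|i ij].
    by rewrite componentM gK ffunE eqxx mul1r.
  by rewrite componentM gK ffunE (negbTE ij) mul0r.
exists a; split; first by apply: (lideal_sum idJ) => i; apply: JM; exact: (xP i).1.
move=> y Jy.
have r i : {r | f y i = r * f (x i) i} by apply: cid; apply: (xP i).2.
exists (g [ffun i : I => sval (r i)]); apply: component_inj => i.
by rewrite componentM gK ffunE aE; apply: svalP (r i).
Qed.

Lemma component_pli i : pli R -> pli (T i).
Proof.
move=> PR J [J0 JD JM].
have [|a [Ja aJ]] := PR (fun x => J (f x i)).
  split=> [|x y Jx Jy|r x Jx]; rewrite ?component0 ?componentD ?componentM //.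
    exact: JD.
  exact: JM.
exists (f a i); split=> // t Jt; have [y yt] := component_surj t.
have [|r yE] := aJ y; first by rewrite yt.
by exists (f r i); rewrite -yt yE componentM.
Qed.

End Product.

(** The (i, j) entry of A E_ji A is the square of A i j. *)
Lemma matrix_domain_semiprime (D : nzRingType) n :
  domain D -> semiprime_elt 'M[D]_n.
Proof.
move=> domD A AMA; apply/matrixP => i j; rewrite mxE.
have /(congr1 (fun B : 'M_n => B i j)) := AMA (delta_mx j i).
rewrite -[_ * _]/(A *m delta_mx j i *m A) !mxE (bigD1 i) //= big1 => [|k ki].
  rewrite addr0 !mxE (bigD1 j) //= big1 => [|k kj].
    by rewrite addr0 !mxE !eqxx mulr1 => /domD[].
  by rewrite !mxE (negbTE kj) mulr0.
rewrite !mxE big1 ?mul0r // => l _.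
by rewrite !mxE (negbTE ki) andbF mulr0.
Qed.

(** * Uniform left ideals *)

Section Uniform.
Variable R : pzRingType.
Implicit Types (u v w x y r s g h : R) (I J : R -> Prop).

(** Uniformity of the module R u, expressed through coefficients so that it
    visibly depends only on the annihilator of u. *)
Definition uniform u := u != 0 /\ forall r s, r * u != 0 -> s * u != 0 ->
  exists p q, p * r * u = q * s * u /\ p * r * u != 0.

(** This gives an isomorphism R u -> R v sending u to v. *)
Definition same_lann u v := forall x, x * u = 0 <-> x * v = 0.

Lemma same_lann_sym u v : same_lann u v -> same_lann v u.
Proof. by move=> uv x; split=> /uv. Qed.

Lemma same_lann_trans v u w : same_lann u v -> same_lann v w -> same_lann u w.
Proof. by move=> uv vw x; split=> [/uv/vw|/vw/uv]. Qed.

Lemma same_lann_eq u v x y : same_lann u v -> x * u = y * u -> x * v = y * v.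
Proof.
move=> uv /eqP; rewrite -subr_eq0 -mulrBl => /eqP/uv/eqP.
by rewrite mulrBl subr_eq0 => /eqP.
Qed.

Lemma same_lann_neq0 u v x : same_lann u v -> x * u != 0 -> x * v != 0.
Proof. by move=> uv; apply: contra_neq => /uv. Qed.

Lemma uniform_same_lann u v : same_lann u v -> uniform u -> uniform v.
Proof.
move=> uv [u0 unif]; split=> [|r s rv sv].
  by move: u0; rewrite -[u]mul1r -[v]mul1r; apply: same_lann_neq0.
have vu := same_lann_sym uv.
have [p [q [pq pr]]] := unif _ _ (same_lann_neq0 vu rv) (same_lann_neq0 vu sv).
by exists p, q; split; [apply: same_lann_eq pq|apply: same_lann_neq0 pr].
Qed.

(** If J is maximal among the left ideals disjoint from some nonzero R y inside I,
    then R y is uniform: from disjoint nonzero R r y and R s y in it, the larger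
    left ideal J + R r y would be disjoint from R s y. *)
Lemma exists_uniform I x : pli R -> lideal I -> I x -> x != 0 ->
  exists u, I u /\ uniform u.
Proof.
move=> PR idI Ix x0.
pose P J := lideal J /\
  exists y, [/\ I y, y != 0 & forall r, J (r * y) -> r * y = 0].
have [J []//||J [[idJ [y [Iy y0 yJ]]] Jmax]] :=
  pli_max (P := P) (F := id) (t0 := fun x => x = 0) PR.
  split; last by exists x.
  by split=> // [z t -> ->|r z ->]; rewrite ?addr0 ?mulr0.
exists y; split=> //; split=> // r s ry sy; apply: contrapT => nopq.
case/eqP: ry; apply: (yJ); apply: (Jmax (isum J (lmul (r * y)))).
- split; first by apply: lideal_isum => //; apply: lideal_lmul.
  exists (s * y); split=> // [|t [j [_ [Jj [p ->] tE]]]].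
    by case: idI => _ _; apply.
  have j0 : j = 0.
    have jE : j = (t * s - p * r) * y by rewrite mulrBl -!mulrA tE addrK.
    by rewrite jE yJ // -jE.
  rewrite {}j0 add0r in tE; apply: contrapT => /eqP tsy; apply: nopq.
  by exists p, t; rewrite -!mulrA -tE.
- by move=> z Jz; apply: isuml => //; apply: lideal_lmul.
- by apply: isumr => //; apply: lmul_id.
Qed.

(** A nonzero homomorphism from a uniform left ideal to R is injective: if its
    kernel were nonzero, it would be essential in R u, so that the annihilator
    of u y would be essential. *)
Lemma uniform_mul_inj u y r : nonsingular R -> uniform u -> u * y != 0 ->
  r * u * y = 0 -> r * u = 0.
Proof.
move=> NS [_ unif] uy ruy; apply: contrapT => /eqP ru.
case/eqP: uy; apply: NS => z z0.
have [zu|zu] := eqVneq (z * u) 0.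
  by exists 1; rewrite !mul1r /lann mulrA zu mul0r.
have [p [q [pq pzu]]] := unif _ _ zu ru; exists p; split.
  by apply: contraNneq pzu => ->; rewrite mul0r.
by rewrite /lann mulrA pq -!mulrA (mulrA r) ruy mulr0.
Qed.

(** For uniform u and v in a semiprime nonsingular ring, this is the relation of
    having isomorphic nonzero submodules in R u and R v. *)
Definition linked u v := exists r, u * r * v != 0.

Lemma not_linked u v : ~ linked u v -> forall r, u * r * v = 0.
Proof. by move=> nuv r; apply: contrapT => /eqP urv; apply: nuv; exists r. Qed.

Lemma linked_same_lann u v w : same_lann v w -> linked u v -> linked u w.
Proof. by move=> vw [r urv]; exists r; apply: same_lann_neq0 urv. Qed.

Section Representatives.
Hypotheses (PR : pli R) (SR : semiprime_elt R).
Let NS : nonsingular R := semiprime_nonsingular PR SR.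

Lemma linked_refl u : u != 0 -> linked u u.
Proof.
move=> u0; apply: contrapT => /not_linked/SR u_0.
by rewrite u_0 eqxx in u0.
Qed.

Lemma linked_sym u v : linked u v -> linked v u.
Proof.
move=> [r urv]; apply: contrapT => /not_linked/(semiprime_sym SR) uv0.
by rewrite uv0 eqxx in urv.
Qed.

(** Right multiplication by s w is nonzero, hence injective, on R v, which
    contains u r v. *)
Lemma linked_trans v u w : uniform v -> linked u v -> linked v w -> linked u w.
Proof.
move=> unif [r urv] [s vsw]; exists (r * v * s).
apply: contraNneq urv => uw0; apply/eqP.
apply: (@uniform_mul_inj v (s * w)) => //; first by rewrite mulrA.
by rewrite -uw0 !mulrA.
Qed.

(** For uniform u this depends only on the class of u: once its default value
    satisfies the predicate, [choose] depends only on the extension of the latter. *)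
Definition representative u := choose (fun w => `[<uniform w /\ linked w u>]) u.

Lemma representativeP u :
  uniform u -> uniform (representative u) /\ linked (representative u) u.
Proof.
move=> unif; apply/asboolP; rewrite /representative.
apply: (@chooseP R (fun w => `[<uniform w /\ linked w u>])).
by apply/asboolP; split=> //; apply: linked_refl; case: unif.
Qed.

Lemma representative_eq u v : uniform u -> uniform v -> linked u v ->
  representative u = representative v.
Proof.
move=> unu unv uv; rewrite /representative.
pose P z : pred R := fun w => `[<uniform w /\ linked w z>].
have PE : P u =1 P v.
  move=> w; apply/asboolP/asboolP => -[unw wl]; split=> //.
    exact: linked_trans unu wl uv.
  exact: linked_trans unv wl (linked_sym uv).
rewrite -[LHS]/(choose (P u) u) (eq_choose PE); apply: choose_id; apply/asboolP.
  by split.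
by split=> //; apply: linked_refl; case: unv.
Qed.

(** R g is isomorphic to the uniform left ideal representing its class.  The
    point of this normalisation is that linked left ideals embed in one another
    but need not be isomorphic. *)
Definition standard g :=
  exists w, [/\ uniform w, representative w = w & same_lann w g].

Lemma standard_same_lann g h : same_lann g h -> standard g -> standard h.
Proof.
by move=> gh [w [? ? wg]]; exists w; split=> //; apply: same_lann_trans gh.
Qed.

Lemma standard_uniform g : standard g -> uniform g.
Proof. by move=> [w [unw _ wg]]; apply: uniform_same_lann unw. Qed.

Lemma standard_dichotomy g h : standard g -> standard h ->
  same_lann g h \/ forall r, g * r * h = 0.
Proof.
move=> [w [unw rw wg]] [z [unz rz zh]].
have [wz|nwz] := pselect (linked w z); [left|right].
  apply: same_lann_trans zh; rewrite -rz -(representative_eq unw unz wz) rw.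
  exact: same_lann_sym.
apply: not_linked => gh; apply: nwz.
apply: linked_same_lann (same_lann_sym zh) _; apply: linked_sym.
by apply: linked_same_lann (same_lann_sym wg) _; apply: linked_sym.
Qed.

(** Inside a uniform R u in I, the nonzero R w r u is a copy of the left ideal R w
    representing the class of u. *)
Lemma exists_standard I x : lideal I -> I x -> x != 0 ->
  exists g, I g /\ standard g.
Proof.
move=> idI Ix x0; have [u [Iu unu]] := exists_uniform PR idI Ix x0.
have [unw wu] := representativeP unu; have [r wru] := wu.
set w := representative u in unw wu wru *.
exists (w * r * u); split; first by case: idI => _ _; apply.
exists w; split=> //; first exact: representative_eq.
move=> y; split=> [yw|]; first by rewrite !mulrA yw !mul0r.
by rewrite -mulrA mulrA; apply: uniform_mul_inj; rewrite // mulrA.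
Qed.

End Representatives.
End Uniform.

(** * Decomposition of the ring into uniform left ideals *)

Section Decomposition.
Variable R : pzRingType.
Implicit Types (x y r g : R).

Definition fcons n x (u : 'I_n -> R) : 'I_n.+1 -> R :=
  fun i => oapp u x (unlift ord0 i).

Lemma fcons_sum n x (u : 'I_n -> R) (r : 'I_n.+1 -> R) :
  \sum_i r i * fcons x u i = r ord0 * x + \sum_i r (lift ord0 i) * u i.
Proof.
rewrite big_ord_recl /fcons unlift_none; congr (_ + _).
by apply: eq_bigr => i _; rewrite liftK.
Qed.

Definition span n (u : 'I_n -> R) y := exists r : 'I_n -> R, y = \sum_i r i * u i.

(** Independence of the left ideals R (u i) rather than of the elements u i: the
    coefficients need not vanish. *)
Definition independent n (u : 'I_n -> R) := forall r : 'I_n -> R,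
  \sum_i r i * u i = 0 -> forall i, r i * u i = 0.

Lemma lideal_span n (u : 'I_n -> R) : lideal (span u).
Proof.
split=> [|_ _ [r ->] [s ->]|t _ [r ->]].
- by exists (fun=> 0); rewrite big1 // => i _; rewrite mul0r.
- exists (fun i => r i + s i); rewrite -big_split.
  by apply: eq_bigr => i _; rewrite mulrDl.
- exists (fun i => t * r i); rewrite mulr_sumr.
  by apply: eq_bigr => i _; rewrite mulrA.
Qed.

Lemma span_gen n (u : 'I_n -> R) i : span u (u i).
Proof.
exists (fun j => (i == j)%:R); rewrite (bigD1 i) //= big1 => [|j ij].
  by rewrite eqxx mul1r addr0.
by rewrite eq_sym (negbTE ij) mul0r.
Qed.

Lemma span_fcons n x (u : 'I_n -> R) y : span u y -> span (fcons x u) y.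
Proof.
move=> [r ->]; exists (fcons 0 r); rewrite fcons_sum /fcons unlift_none mul0r add0r.
by apply: eq_bigr => i _; rewrite liftK.
Qed.

Lemma span_fcons_head n x (u : 'I_n -> R) : span (fcons x u) x.
Proof.
by have := span_gen (fcons x u) ord0; rewrite [fcons _ _ _]/fcons unlift_none.
Qed.

Lemma independent_fcons n x (u : 'I_n -> R) : independent u ->
  (forall r, span u (r * x) -> r * x = 0) -> independent (fcons x u).
Proof.
move=> indu xu r; rewrite fcons_sum => sum0.
have rx0 : r ord0 * x = 0.
  apply: xu; exists (fun i => - r (lift ord0 i)).
  rewrite -[LHS](addrK (\sum_i r (lift ord0 i) * u i)) sum0 add0r -sumrN.
  by apply: eq_bigr => i _; rewrite mulNr.
rewrite rx0 add0r in sum0; move=> i.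
case: (unliftP ord0 i) => [j|] ->; rewrite /fcons ?liftK ?unlift_none //.
exact: (indu _ sum0).
Qed.

Hypotheses (PR : pli R) (SR : semiprime_elt R).
Let NS : nonsingular R := semiprime_nonsingular PR SR.

(** In a family with maximal span, a nonzero R x disjoint from the span would
    contain a standard g, by which the family could be extended. *)
Lemma exists_essential_family : exists n (u : 'I_n -> R),
  [/\ forall i, standard (u i), independent u & essential (span u)].
Proof.
pose P (t : {n & 'I_n -> R}) :=
  (forall i, standard (tagged t i)) /\ independent (tagged t).
pose F (t : {n & 'I_n -> R}) := span (tagged t).
pose t0 : {n & 'I_n -> R} := existT (fun n => 'I_n -> R) 0 (fun=> 0).
have [t _||[n u] [[/= stu indu] umax]] := pli_max (P := P) (F := F) (t0 := t0) PR.
- exact: lideal_span.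
- by split=> [[]|r _ []].
exists n, u; split=> // x x0; apply: contrapT => nox.
have xu r : span u (r * x) -> r * x = 0.
  by move=> rxu; apply: contrapT => /eqP rx; apply: nox; exists r.
have [g [[s gE] stg]] := exists_standard PR SR (lideal_lmul x) (lmul_id x) x0.
have [/eqP g0 _] := standard_uniform stg; apply: g0; rewrite gE; apply: (xu).
rewrite -gE; apply: (umax (existT _ n.+1 (fcons g u))) => [|y|/=].
- split=> [i|]; last by apply: independent_fcons => // r; rewrite gE mulrA; apply: xu.
  by rewrite /= /fcons; case: (unliftP ord0 i) => [j|] _ //=.
- exact: span_fcons.
- exact: span_fcons_head.
Qed.

(** The essential direct sum of the R (u i) is R c with c regular, hence is
    isomorphic to R.  Writing u i = b i * c and c = \sum_i a i * u i transports
    the decomposition to R: the a i * b i are orthogonal idempotents with sum 1,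
    and R b i is isomorphic to R (u i). *)
Lemma exists_decomposition : exists n (a b : 'I_n -> R),
  [/\ forall i, uniform (b i), \sum_i a i * b i = 1,
      forall i j, b i * a j * b j = if i == j then b j else 0
    & forall i j, same_lann (b i) (b j) \/ forall r, b i * r * b j = 0].
Proof.
have [n [u [stu indu eu]]] := exists_essential_family.
have [c [[a cE] uc creg]] := essential_generator PR NS (lideal_span u) eu.
have [b bE] := choice (fun i => uc _ (span_gen u i)).
have ub i : same_lann (u i) (b i).
  move=> x; rewrite bE mulrA; split=> [/creg//|->]; exact: mul0r.
have stb i : standard (b i) := standard_same_lann (ub i) (stu i).
exists n, a, b; split=> [i||i j|i j].
- exact: standard_uniform (stb i).
- apply/eqP; rewrite -subr_eq0; apply/eqP/creg; rewrite mulrBl mul1r mulr_suml.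
  by rewrite {2}cE -sumrB big1 // => i _; rewrite bE mulrA subrr.
- pose r k := b i * a k - (i == k)%:R.
  have rE k : r k * u k = b i * a k * u k - (if i == k then u k else 0).
    by rewrite mulrBl; case: eqP; rewrite ?mul1r ?mul0r.
  have /(_ j) : forall j, r j * u j = 0.
    apply: indu; under eq_bigr do rewrite rE.
    rewrite sumrB -big_mkcond (big_pred1 i) => [|k]; last by rewrite eq_sym.
    rewrite [u i]bE cE mulr_sumr; apply/eqP; rewrite subr_eq0; apply/eqP.
    by apply: eq_bigr => k _; rewrite mulrA.
  move=> /(ub j); rewrite mulrBl => /eqP; rewrite subr_eq0 => /eqP ->.
  by case: eqP; rewrite ?mul1r ?mul0r.
- exact: standard_dichotomy.
Qed.

End Decomposition.

(** * Corner rings *)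

Record idempotent (R : pzRingType) := Idempotent {
  idem_val : R;
  idemK : idem_val * idem_val = idem_val;
  idem_neq0 : idem_val != 0 }.

Section Corner.
Variables (R : pzRingType) (E : idempotent R).
Implicit Types x y : R.
Local Notation e := (idem_val E).

Definition corner_pred : {pred R} := fun x => e * x * e == x.

Fact corner_zmod_closed : zmod_closed corner_pred.
Proof.
split=> [|x y]; rewrite !unfold_in; first by rewrite mulr0 mul0r.
by move=> /eqP xE /eqP yE; rewrite mulrBr mulrBl xE yE.
Qed.
HB.instance Definition _ :=
  GRing.isZmodClosed.Build R corner_pred corner_zmod_closed.

Record corner := Corner { corner_val : R; _ : corner_val \in corner_pred }.
HB.instance Definition _ := [isSub for corner_val].
HB.instance Definition _ := [Choice of corner by <:].
HB.instance Definition _ := [SubChoice_isSubZmodule of corner by <:].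
Implicit Types X Y Z : corner.

Lemma cornerP X : e * val X * e = val X.
Proof. exact/eqP/(valP X). Qed.

Lemma corner_idl X : e * val X = val X.
Proof. by rewrite -cornerP -mulrA mulrA idemK mulrA. Qed.

Lemma corner_idr X : val X * e = val X.
Proof. by rewrite -cornerP -mulrA idemK. Qed.

Fact to_corner_subproof x : e * x * e \in corner_pred.
Proof. by apply/eqP; rewrite -!mulrA idemK !mulrA idemK. Qed.
Definition to_corner x : corner := Corner (to_corner_subproof x).

Lemma cornerDE X Y : val (X + Y) = val X + val Y. Proof. exact: raddfD. Qed.
Lemma cornerBE X Y : val (X - Y) = val X - val Y. Proof. exact: raddfB. Qed.
Lemma corner0E : val (0 : corner) = 0. Proof. exact: raddf0. Qed.

Let one := to_corner 1.
Let mul X Y := to_corner (val X * val Y).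

Lemma val_corner1 : val one = e.
Proof. by rewrite /= mulr1 idemK. Qed.

Lemma val_cornerM X Y : val (mul X Y) = val X * val Y.
Proof. by rewrite /= mulrA corner_idl -mulrA corner_idr. Qed.

Fact corner_mulA : associative mul.
Proof. by move=> X Y Z; apply: val_inj; rewrite !val_cornerM mulrA. Qed.
Fact corner_mul1l : left_id one mul.
Proof. by move=> X; apply: val_inj; rewrite val_cornerM val_corner1 corner_idl. Qed.
Fact corner_mul1r : right_id one mul.
Proof. by move=> X; apply: val_inj; rewrite val_cornerM val_corner1 corner_idr. Qed.
Fact corner_mulDl : left_distributive mul +%R.
Proof.
by move=> X Y Z; apply: val_inj; rewrite cornerDE !val_cornerM cornerDE mulrDl.
Qed.
Fact corner_mulDr : right_distributive mul +%R.
Proof.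
by move=> X Y Z; apply: val_inj; rewrite cornerDE !val_cornerM cornerDE mulrDr.
Qed.
Fact corner_neq0 : one != 0.
Proof. by rewrite -val_eqE val_corner1 corner0E idem_neq0. Qed.
HB.instance Definition _ := GRing.Zmodule_isNzRing.Build corner
  corner_mulA corner_mul1l corner_mul1r corner_mulDl corner_mulDr corner_neq0.

Lemma corner1E : val (1 : corner) = e. Proof. exact: val_corner1. Qed.
Lemma cornerME X Y : val (X * Y) = val X * val Y. Proof. exact: val_cornerM. Qed.

Lemma corner_sumE (I : finType) (F : I -> corner) :
  val (\sum_i F i) = \sum_i val (F i).
Proof. exact: raddf_sum. Qed.

(** By right multiplication e R e acts on the uniform left ideal R e, and nonzero
    endomorphisms of the latter are injective. *)
Lemma corner_domain : nonsingular R -> uniform e -> domain corner.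
Proof.
move=> NS une X Y XY; have [->|Y0] := eqVneq Y 0; [by right|left].
apply: val_inj; rewrite corner0E -corner_idr.
apply: (uniform_mul_inj (y := val Y) NS une).
  by rewrite corner_idl -corner0E val_eqE.
by rewrite corner_idr -cornerME XY corner0E.
Qed.

(** A left ideal L of e R e is recovered from the left ideal of the x in R e
    with e R x contained in L. *)
Lemma corner_noetherian : pli R -> left_noetherian corner.
Proof.
move=> PR L incL.
pose F m x := x * e = x /\ forall r, exists2 T, T \in L m & val T = e * r * x.
have [m|m x [xe eRx]|n nF] := pli_acc (F := F) PR.
- split=> [|x y [xe eRx] [ye eRy]|s x [xe eRx]].
  + by split=> [|r]; [rewrite mul0r|exists 0; rewrite ?rpred0 ?corner0E ?mulr0].
  + split=> [|r]; first by rewrite mulrDl xe ye.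
    have [T LT TE] := eRx r; have [U LU UE] := eRy r.
    by exists (T + U); rewrite ?rpredD // cornerDE mulrDr TE UE.
  + split=> [|r]; first by rewrite -mulrA xe.
    by have [T LT TE] := eRx (r * s); exists T; rewrite // TE !mulrA.
- by split=> // r; have [T LT TE] := eRx r; exists T; rewrite ?incL.
have incLn m k : {subset L m <= L (k + m)%N}.
  by elim: k => // k IH X /IH /incL.
exists n => m nm X; apply/idP/idP => [LX|]; last by rewrite -(subnK nm); apply: incLn.
have [_ /(_ 1)[T LT TE]] : F n (val X).
  apply: (nF m); split=> [|r]; first exact: corner_idr.
  exists (to_corner r * X); first exact: mem_lmul.
  by rewrite cornerME /= -!mulrA corner_idl mulrA.
by have <- : T = X by apply: val_inj; rewrite TE mulr1 corner_idl.
Qed.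

End Corner.

(** * The ring as a product of matrix rings over corners *)

Lemma finite_classes (T : finType) (E : T -> T -> Prop) :
  (forall x, E x x) -> (forall x y, E x y -> E y x) ->
  (forall x y z, E x y -> E y z -> E x z) ->
  exists m (cls : T -> 'I_m) (sec : 'I_m -> T),
    (forall k, cls (sec k) = k) /\ (forall x y, cls x = cls y <-> E x y).
Proof.
move=> Erefl Esym Etrans.
pose C x := [set y | `[<E x y>]]; pose P := C @: [set: T].
have CP x : C x \in P by apply: imset_f; rewrite in_setT.
pose cls x : 'I_#|P| := enum_rank_in (CP x) (C x).
have clsK x : enum_val (cls x) = C x by apply: enum_rankK_in; apply: CP.
have clsE x y : cls x = cls y <-> E x y.
  split=> [/(congr1 (fun k => enum_val k))|xy].
    by rewrite !clsK => /setP/(_ y); rewrite !inE (asboolT (Erefl y)) => /asboolP.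
  apply: enum_val_inj; rewrite !clsK; apply/setP => z; rewrite !inE.
  apply/asboolP/asboolP; first exact: Etrans (Esym _ _ xy).
  exact: Etrans xy.
have sec k : {x | cls x = k}.
  apply: cid; have /imsetP[x _ xE] := enum_valP k.
  by exists x; apply: enum_val_inj; rewrite clsK.
by exists #|P|, cls, (fun k => sval (sec k)); split=> // k; apply: svalP (sec k).
Qed.

(** Right multiplications by a and by b are mutually inverse between R b and
    R (b a), and b a is idempotent. *)
Lemma generator_idempotent (R : pzRingType) (a b : R) : b != 0 ->
  b * a * b = b -> exists e : idempotent R, same_lann b (idem_val e).
Proof.
move=> b0 bab; have idem : b * a * (b * a) = b * a by rewrite mulrA bab.
have ba0 : b * a != 0.
  by apply: contraNneq b0 => ba0; rewrite -bab ba0 mul0r.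
exists (Idempotent idem ba0) => x /=; split=> [xb|xba].
  by rewrite mulrA xb mul0r.
by rewrite -bab mulrA xba mul0r.
Qed.

Section MatrixDecomposition.
Variables (R : pzRingType) (n m : nat) (a b : 'I_n -> R).
Variables (cls : 'I_n -> 'I_m) (E : 'I_m -> idempotent R).
Local Notation e k := (idem_val (E k)).
Hypothesis sum_ab : \sum_i a i * b i = 1.
Hypothesis ab_orth :
  forall i j, b i * a j * b j = if i == j then b j else 0.
Hypothesis b_same : forall i, same_lann (b i) (e (cls i)).
Hypothesis b_diff : forall i j r, cls i <> cls j -> b i * r * b j = 0.

Lemma class_idem_b k i : cls i = k -> e k * b i = b i.
Proof.
move=> <-; rewrite -[RHS]mul1r.
by apply: (same_lann_eq (same_lann_sym (b_same i))); rewrite idemK mul1r.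
Qed.

(** In the orthogonality relations the right factor b j can be replaced by one
    that is common to the class of j. *)
Lemma ab_class k i j : cls j = k -> b i * a j * e k = if i == j then e k else 0.
Proof.
move=> <-; have bj := b_same j; case: eqP => [->|/eqP ij].
  by rewrite -[RHS]mul1r; apply: (same_lann_eq bj); rewrite ab_orth eqxx mul1r.
by apply/bj; rewrite ab_orth (negbTE ij).
Qed.

Definition block_size k := #|[pred i | cls i == k]|.
Definition block k (p : 'I_(block_size k)) : 'I_n := enum_val p.

Lemma cls_block k p : cls (@block k p) = k.
Proof. by apply/eqP; apply: (enum_valP p). Qed.

Lemma block_inj k : injective (@block k).
Proof. exact: enum_val_inj. Qed.

Lemma sum_block k (f : 'I_n -> R) :
  \sum_(i | cls i == k) f i = \sum_(p < block_size k) f (block p).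
Proof. exact: (big_enum_val (A := [pred i | cls i == k])). Qed.

Local Notation D k := (corner (E k)).
Local Notation prodM := {dffun forall k : 'I_m, 'M[D k]_(block_size k)}.

(** The (i, j) component of right multiplication by r on R, the direct sum of the
    R b i, when R b i and R b j are both identified with R e: it sends e, that is
    b i, to the component b i r a j b j of b i r, that is to b i r a j e. *)
Definition to_matrices (r : R) : prodM :=
  [ffun k : 'I_m =>
    \matrix_(p, q) to_corner (E k) (b (block p) * r * a (block q))].

Definition of_matrices (X : prodM) : R :=
  \sum_k \sum_p \sum_q a (block p) * val (X k p q) * b (block q).

Lemma to_matricesE r k p q : val (to_matrices r k p q) =
  b (block p) * r * a (block q) * e k.
Proof.
rewrite /to_matrices ffunE mxE /=.
by rewrite !mulrA class_idem_b ?cls_block.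
Qed.

(** Only the terms of a single class survive in b i x (\sum_j a j b j). *)
Lemma sum_ab_class i x : \sum_(j | cls j == cls i) b i * x * a j * b j = b i * x.
Proof.
rewrite -[RHS]mulr1 -sum_ab mulr_sumr [RHS](bigID (fun j => cls j == cls i)) /=.
rewrite [X in _ = _ + X]big1 => [|j /eqP ij]; last first.
  by rewrite mulrA -(mulrA (b i)) b_diff // => /esym.
by rewrite addr0; apply: eq_bigr => j _; rewrite mulrA.
Qed.

Lemma to_matrices_zmod : zmod_morphism to_matrices.
Proof.
move=> r s; apply/ffunP => k; apply/matrixP => p q; apply: val_inj.
rewrite to_matricesE mulrBr !mulrBl -!to_matricesE.
by rewrite !ffunE !mxE cornerBE.
Qed.

Lemma to_matrices_monoid : monoid_morphism to_matrices.
Proof.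
split=> [|r s]; apply/ffunP => k; apply/matrixP => p q; apply: val_inj.
  rewrite to_matricesE mulr1 ab_class ?cls_block // (inj_eq (@block_inj k)).
  by rewrite ffunE mxE; case: eqP => _; rewrite ?corner1E ?corner0E.
rewrite to_matricesE (mulrA (b _) r s) -(sum_ab_class (block p) r) cls_block.
rewrite sum_block !mulr_suml ffunE [RHS]/= mxE corner_sumE.
apply: eq_bigr => t _; rewrite cornerME !to_matricesE !mulrA.
by rewrite -(mulrA _ (e k) (b _)) class_idem_b ?cls_block.
Qed.

Lemma to_matricesK : cancel to_matrices of_matrices.
Proof.
move=> r; rewrite -[RHS]mul1r -sum_ab mulr_suml (partition_big cls xpredT) //=.
apply: eq_bigr => k _; rewrite sum_block; apply: eq_bigr => p _.
rewrite -mulrA -(sum_ab_class (block p) r) cls_block sum_block mulr_sumr.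
apply: eq_bigr => q _; rewrite to_matricesE -!mulrA.
by rewrite class_idem_b ?cls_block.
Qed.

Lemma of_matricesK : cancel of_matrices to_matrices.
Proof.
move=> X; apply/ffunP => k; apply/matrixP => p q; apply: val_inj.
have rowX l (p' q' : 'I_(block_size l)) : b (block p) * a (block p') *
    val (X l p' q') = if block p == block p' then val (X l p' q') else 0.
  rewrite -corner_idl mulrA ab_class ?cls_block //.
  by case: eqP; rewrite ?mul0r.
(* Left multiplication by b i extracts the i-th row of X, in the class of i. *)
have bX : b (block p) * of_matrices X = \sum_t val (X k p t) * b (block t).
  rewrite mulr_sumr (bigD1 k) //= [X in _ + X]big1 => [|l lk]; last first.
    rewrite mulr_sumr big1 // => p' _; rewrite mulr_sumr big1 // => q' _.
    rewrite !mulrA rowX; case: eqP => [pp'|]; last by rewrite mul0r.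
    by move: lk; rewrite -(cls_block p) pp' cls_block eqxx.
  rewrite addr0 mulr_sumr (bigD1 p) //= [X in _ + X]big1 => [|p' pp'].
    rewrite addr0 mulr_sumr; apply: eq_bigr => t _.
    by rewrite !mulrA rowX eqxx.
  rewrite mulr_sumr big1 // => t _; rewrite !mulrA rowX.
  by rewrite (inj_eq (@block_inj k)) eq_sym (negbTE pp') mul0r.
rewrite to_matricesE bX !mulr_suml (bigD1 q) //= big1 => [|t tq].
  by rewrite -!mulrA (mulrA (b _)) ab_class ?cls_block // eqxx corner_idr addr0.
rewrite -!mulrA (mulrA (b _)) ab_class ?cls_block //.
by rewrite (inj_eq (@block_inj k)) (negbTE tq) mulr0.
Qed.

HB.instance Definition _ := GRing.isZmodMorphism.Build R prodM to_matrices
  to_matrices_zmod.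
HB.instance Definition _ := GRing.isMonoidMorphism.Build R prodM to_matrices
  to_matrices_monoid.

Lemma matrix_decomposition : isomorphic_rings R prodM.
Proof.
exists to_matrices; exists of_matrices; first exact: to_matricesK.
exact: of_matricesK.
Qed.

End MatrixDecomposition.

(** * Semiprime rings with principal left ideals *)

(** The summands R b i of the decomposition, grouped into isomorphism classes,
    give the matrix blocks; left ideals of a block are principal because the block
    is a quotient of R. *)
Lemma semiprime_pli_matrix_product (R : nzRingType) :
  pli R -> semiprime_elt R ->
  exists (k : nat) (n : 'I_k -> nat) (D : 'I_k -> nzRingType),
    [/\ (0 < k)%N,
        forall i, (0 < n i)%N,
        forall i, domain (D i) /\ left_noetherian (D i),
        forall i, principal_left_ideal_ring 'M[D i]_(n i)
      & isomorphic_rings R {dffun forall i : 'I_k, 'M[D i]_(n i)}].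
Proof.
move=> PR SR; have NS := semiprime_nonsingular PR SR.
have [n [a [b [unb sum_ab ab_orth bb]]]] := exists_decomposition PR SR.
have [//|i j|i j l|m [cls [sec [secK clsE]]]] :=
  @finite_classes 'I_n (fun i j => same_lann (b i) (b j)).
- exact: same_lann_sym.
- exact: same_lann_trans.
have [E bE] : exists E : 'I_m -> idempotent R,
    forall i, same_lann (b i) (idem_val (E (cls i))).
  have secE k : exists e : idempotent R, same_lann (b (sec k)) (idem_val e).
    apply: (@generator_idempotent R (a (sec k))); first by case: (unb (sec k)).
    by rewrite ab_orth eqxx.
  have [E secE'] := choice secE; exists E => i.
  by apply: same_lann_trans (secE' _); apply/clsE; rewrite secK.
have b_diff i j r : cls i <> cls j -> b i * r * b j = 0.
  by move=> ij; case: (bb i j) => [/clsE|].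
have isoR := matrix_decomposition sum_ab ab_orth bE b_diff.
exists m, (block_size cls), (fun k => corner (E k)); split=> // [|k|k|k].
- case: (posnP m) => // m0; have := oner_neq0 R.
  rewrite -sum_ab big1 ?eqxx // => i _.
  by have := leq_ltn_trans (leq0n _) (ltn_ord (cls i)); rewrite {1}m0.
- by apply/card_gt0P; exists (sec k); rewrite inE secK.
- split; last exact: corner_noetherian.
  apply: corner_domain => //; apply: uniform_same_lann (unb (sec k)).
  by have := bE (sec k); rewrite secK.
- apply/pliP; have [f f_bij] := isoR.
  exact: (component_pli f_bij PR).
Qed.

Theorem theorem3p4 (R : nzRingType) :
  [<-> left_virtually_semisimple R;
       semiprime R /\ principal_left_ideal_ring R;
       left_hereditary R /\ principal_left_ideal_ring R;
       exists (k : nat) (n : 'I_k -> nat) (D : 'I_k -> nzRingType),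
         [/\ (0 < k)%N,
             forall i, (0 < n i)%N,
             forall i, domain (D i) /\ left_noetherian (D i),
             forall i, principal_left_ideal_ring 'M[D i]_(n i)
           & isomorphic_rings R {dffun forall i : 'I_k, 'M[D i]_(n i)}]].
Proof.
tfae.
- move=> VR; have PR := virtually_semisimple_pli VR; split; last exact/pliP.
  apply: nonsingular_semiprime => //; apply: projective_gen_nonsingular => a.
  exact: virtually_semisimple_projective_gen.
- move=> [/semiprime_eltP SR /pliP PR]; split; last exact/pliP.
  apply: projective_gen_hereditary => // a; apply: nonsingular_projective_gen => //.
  exact: semiprime_nonsingular.
- move=> [HR /pliP PR]; apply: semiprime_pli_matrix_product => //.
  apply: semiprime_eltP; apply: nonsingular_semiprime => //.
  apply: projective_gen_nonsingular => a; exact: hereditary_projective_gen.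
- move=> [k [n [D [_ _ domD PM [f f_bij]]]]].
  have PR : pli R by apply: (product_pli f_bij) => i; apply/pliP; apply: PM.
  apply: projective_gen_virtually_semisimple => // a.
  apply: nonsingular_projective_gen => //; apply: semiprime_nonsingular => //.
  apply: (product_semiprime f_bij) => i; apply: matrix_domain_semiprime.
  by case: (domD i).
Qed.
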